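(* Let $T$ be a total pivoted caterpillar. Then $T$ admits a total b-chromatic $(m_t(T)-1)$-colouring, and hence $\varphi_t(T)=m_t(T)-1$.
   Context: A caterpillar is a tree $T$ with a central path $\mathcal{P}$ (the path formed by its non-leaf vertices) such that every leaf is at distance one from $\mathcal{P}$. For a simple graph: elements are vertices and edges; two elements are adjacent if they are adjacent vertices, a vertex and an incident edge, or two distinct edges sharing an endpoint; $N_t(x)$ is the set of elements adjacent to $x$ and $d_t(x)=|N_t(x)|$. With elements ordered by non-increasing total degree $d_t(x_1)\ge d_t(x_2)\ge\cdots$, $m_t(G)=\max\{i:d_t(x_i)\ge i-1\}$. With $m=m_t(G)$, an element $x$ is total dense if $d_t(x)\ge m-1$. A path $\langle w_1,\dots,w_k\rangle$ is a total dense path if $w_2,\dots,w_{k-1}$ are total dense and every edge $(w_i,w_{i+1})$ is total dense; its length $\ell$ is its number of edges. Two paths are adjacent if the last vertex of one equals the first vertex of the other. A caterpillar $T$ with central path $\mathcal{P}$, $m=m_t(T)\ge 6$ and exactly $m$ total dense elements is total pivoted if either (1) there is a total dense vertex $u$ with $d(u)=m-2$ having a neighbour $u'$ with $d(u')=2$ that is adjacent to a total dense vertex $v\ne u$ (type 1); or (2) there are paths $P_1,P_2,Q\subseteq\mathcal{P}$ such that $P_1,P_2$ are the only total dense paths of $T$, each contains exactly three total dense elements, $Q$ has $\ell(Q)\le 1$ and no total dense element, and $Q$ is adjacent to both $P_1$ and $P_2$ (type 2). A total $k$-colouring is a surjective map from elements to $\{1,\dots,k\}$ giving adjacent elements different colours;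 an element $x$ is total b-chromatic if its total neighbourhood receives all colours other than $\mathbf{c}(x)$; a total b-chromatic $k$-colouring has a total b-chromatic element in every colour class; $\varphi_t(T)$ is the maximum such $k$. *)

(* Defs.v *)
From mathcomp Require Import all_boot.

Set Implicit Arguments.
Unset Strict Implicit.
Unset Printing Implicit Defensive.

Record sgraph := SGraph {
  vertex :> finType;
  adj : rel vertex;
  adj_sym : symmetric adj;
  adj_irrefl : irreflexive adj
}.

Arguments adj {s} _ _.

Definition deg (G : sgraph) (v : G) : nat := #|[set w | adj v w]|.

Definition is_edge (G : sgraph) (A : {set G}) : bool :=
  [exists u, exists v, adj u v && (A == [set u; v])].

Definition edge (G : sgraph) : finType := {A : {set G} | is_edge A}.

Definition element (G : sgraph) : finType := (vertex G + edge G)%type.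

Definition tadj (G : sgraph) (x y : element G) : bool :=
  match x, y with
  | inl u, inl v => adj u v
  | inl u, inr f => u \in val f
  | inr f, inl v => v \in val f
  | inr f, inr g => (f != g) && (val f :&: val g != set0)
  end.

Definition total_nbh (G : sgraph) (x : element G) : {set element G} :=
  [set y | tadj x y].

Definition total_deg (G : sgraph) (x : element G) : nat := #|total_nbh x|.

Definition total_deg_seq (G : sgraph) : seq nat :=
  sort geq [seq total_deg x | x : element G].

(* [total_deg_seq] is indexed from 0: its item [i] is d_t(x_{i+1}), and the
   condition d_t(x_{i+1}) >= (i+1) - 1 contributes the value i+1. *)
Definition m_t (G : sgraph) : nat :=
  \max_(i < size (total_deg_seq G) | i <= nth 0 (total_deg_seq G) i) i.+1.

Definition total_dense (G : sgraph) (x : element G) : bool :=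
  m_t G - 1 <= total_deg x.

Definition connected (G : sgraph) : Prop := forall u v : G, connect adj u v.

(* In a simple graph the duplicate-free [cycle]s of [path] with at most two
   vertices are the empty one and the traversals of a single edge. *)
Definition acyclic (G : sgraph) : Prop :=
  forall c : seq G, cycle adj c -> uniq c -> size c <= 2.

Definition tree (G : sgraph) : Prop := [/\ 0 < #|G|, connected G & acyclic G].

Definition leaf (G : sgraph) (v : G) : bool := deg v == 1.

(* Paths are nonempty sequences of distinct vertices; a single vertex is a
   path of length 0. *)
Definition gpath (G : sgraph) (p : seq G) : bool :=
  [&& p != [::], sorted adj p & uniq p].

Definition path_length (G : sgraph) (p : seq G) : nat := (size p).-1.

Definition on_path (G : sgraph) (p : seq G) (x : element G) : bool :=
  match x with
  | inl v => v \in p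
  | inr f => [exists u, exists v, infix [:: u; v] p && (val f == [set u; v])]
  end.

Definition same_path (G : sgraph) (p q : seq G) : bool :=
  (p == q) || (p == rev q).

Definition path_adjacent (G : sgraph) (p q : seq G) : Prop :=
  (exists v p' q', p = rcons p' v /\ q = v :: q') \/
  (exists v p' q', q = rcons q' v /\ p = v :: p').

Definition central_path (G : sgraph) (P : seq G) : Prop :=
  gpath P /\ forall v : G, (v \in P) = ~~ leaf v.

Definition caterpillar (G : sgraph) (P : seq G) : Prop :=
  [/\ tree G, central_path P &
      forall v : G, leaf v -> exists2 w, w \in P & adj v w].

(* The conditions on interior vertices and edges are vacuous for one-vertex
   paths. Such a path counts only when its vertex is total dense, which is
   what the last condition expresses; for a longer path it already follows
   from the condition on edges. *)
Definition total_dense_path (G : sgraph) (p : seq G) : Prop :=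
  [/\ gpath p,
      forall u v w : G, infix [:: u; v; w] p -> total_dense (inl v : element G),
      forall f : edge G, on_path p (inr f) -> total_dense (inr f : element G) &
      exists2 x : element G, on_path p x & total_dense x].

Definition maximal_total_dense_path (G : sgraph) (p : seq G) : Prop :=
  total_dense_path p /\
  forall q : seq G, total_dense_path q -> infix p q -> q = p.

Definition total_dense_on (G : sgraph) (p : seq G) : {set element G} :=
  [set x | on_path p x & total_dense x].

Definition pivoted_type1 (G : sgraph) : Prop :=
  exists u u' v : G,
    [/\ total_dense (inl u : element G) /\ deg u = m_t G - 2,
        adj u u' /\ deg u' = 2 &
        [/\ adj u' v, total_dense (inl v : element G) & v != u]].

(* A subpath of a total dense path is again total dense, so "the only total
   dense paths" refers to the maximal ones, each path being identified with
   its reversal. *)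
Definition pivoted_type2 (G : sgraph) (P : seq G) : Prop :=
  exists P1 P2 Q : seq G,
    [/\ [/\ {subset P1 <= P}, {subset P2 <= P} & {subset Q <= P}],
        ~~ same_path P1 P2 /\
        (forall p : seq G, maximal_total_dense_path p <->
                           same_path p P1 || same_path p P2),
        #|total_dense_on P1| = 3 /\ #|total_dense_on P2| = 3,
        [/\ gpath Q, path_length Q <= 1 & total_dense_on Q = set0] &
        path_adjacent Q P1 /\ path_adjacent Q P2].

Definition total_pivoted_caterpillar (G : sgraph) : Prop :=
  exists P : seq G,
    [/\ caterpillar P, 6 <= m_t G,
        #|[set x : element G | total_dense x]| = m_t G &
        pivoted_type1 G \/ pivoted_type2 P].

Definition total_colouring (G : sgraph) (k : nat)
    (c : {ffun element G -> 'I_k}) : bool :=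
  [forall i, exists x, c x == i] &&
  [forall x, forall y, tadj x y ==> (c x != c y)].

Definition total_b_chromatic (G : sgraph) (k : nat)
    (c : {ffun element G -> 'I_k}) (x : element G) : bool :=
  [forall (i | i != c x), exists y in total_nbh x, c y == i].

Definition total_b_colouring (G : sgraph) (k : nat)
    (c : {ffun element G -> 'I_k}) : bool :=
  total_colouring c &&
  [forall i, exists x, (c x == i) && total_b_chromatic c x].

Definition has_total_b_colouring (G : sgraph) (k : nat) : bool :=
  [exists c : {ffun element G -> 'I_k}, total_b_colouring c].

(* Colourings are surjective, so no colouring uses more colours than there are
   elements and the range of this maximum is not a restriction. *)
Definition phi_t (G : sgraph) : nat :=
  \max_(k < #|element G|.+1 | has_total_b_colouring G k) k.

Lemma phi_t_max (G : sgraph) (k : nat) :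
  has_total_b_colouring G k -> k <= phi_t G.
Proof.
move=> Hk; have lek : k < #|element G|.+1.
  case/existsP: Hk => c /andP[/andP[/forallP csurj _] _].
  rewrite ltnS -[X in X <= _]card_ord.
  have -> : #|'I_k| = #|codom c|.
    by apply: eq_card => i; have /existsP[x /eqP <-] := csurj i; rewrite codom_f.
  by rewrite leq_image_card.
exact: (bigmax_sup (Ordinal lek)).
Qed.

(* Main.v *)
(* In both types a total b-chromatic [m]-colouring would have to use the [m] total
   dense elements as its b-chromatic elements, one for each colour.

   Type 1: the total dense elements are [u], the edges at [u] and [v]. The edge
   [uu'] can see the colour of [v] only on [u'] or on [u'v], which are adjacent to
   [v]. With [m - 1] colours, give different colours to [u] and its edges, which
   form a clique, and the colour of [u] to [v].

   Type 2: [m = 6] and the total dense paths are [a, b, x] and [d, c, y] with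
   [deg b = deg c = 3], [deg x = deg y = 2] and [x = y] or [xy] an edge. If [x = y],
   then [bx] sees the colour of [cd] only on [x], and [xc] that of [ab] only on [x].
   If [xy] is an edge, then [bx] forces on [xy] the colour of one of [c], [cd], [yc],
   and [yc] forces on it the colour of one of [b], [ab], [bx]. With five colours,
   [ab], [bx], [b], the third edge [bw] at [b], and [x] are made b-chromatic.

   In both cases all total dense elements are precoloured, and the elements left
   have total degree less than the number of colours: colour them greedily. *)
Require Import Defs.
From mathcomp Require Import all_boot zify.

Set Implicit Arguments.
Unset Strict Implicit.
Unset Printing Implicit Defensive.

(** * Edges as two-element vertex sets, and total degrees *)

Lemma set2_eq (V : finType) (a b c d : V) :
  ([set a; b] == [set c; d]) = (a == c) && (b == d) || (a == d) && (b == c).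
Proof.
apply/eqP/idP => [E | /orP[/andP[/eqP-> /eqP->] | /andP[/eqP-> /eqP->]] //]; last by rewrite setUC.
have S z : (z \in [set a; b]) = (z \in [set c; d]) by rewrite E.
have := S a; have := S b; have := S c; have := S d; rewrite !inE !eqxx !orbT /=.
rewrite (eq_sym c a) (eq_sym c b) (eq_sym d a) (eq_sym d b).
by case: (a == c); case: (b == d); case: (a == d); case: (b == c).
Qed.

Lemma set2_meet (V : finType) (a b c d : V) :
  ([set a; b] :&: [set c; d] != set0) = [|| a == c, a == d, b == c | b == d].
Proof.
apply/set0Pn/idP => [[z]|].
  by rewrite !inE => /andP[/orP[/eqP->|/eqP->] /orP[]->]; rewrite ?orbT.
by case/or4P=> /eqP->; [exists c | exists d | exists c | exists d]; rewrite !inE eqxx ?orbT.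
Qed.

Lemma adj_neq (G : sgraph) (u v : G) : adj u v -> u != v.
Proof. by apply: contraTneq => ->; rewrite adj_irrefl. Qed.

Lemma tadj_sym (G : sgraph) : symmetric (@tadj G).
Proof.
by move=> [u|f] [v|g] //=; rewrite ?(adj_sym u) // eq_sym setIC.
Qed.

Lemma tadj_irrefl (G : sgraph) : irreflexive (@tadj G).
Proof. by move=> [u|f] /=; rewrite ?adj_irrefl ?eqxx. Qed.

Lemma edge_exists (G : sgraph) (u v : G) :
  adj u v -> exists e : edge G, val e = [set u; v].
Proof.
move=> uv; have E : is_edge [set u; v].
  by apply/existsP; exists u; apply/existsP; exists v; rewrite uv eqxx.
by exists (Sub _ E).
Qed.

Lemma edge_endpoints (G : sgraph) (f : edge G) :
  exists u v, adj u v /\ val f = [set u; v].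
Proof.
have /existsP[u /existsP[v /andP[uv /eqP E]]] := valP f.
by exists u, v.
Qed.

Lemma edge_at (G : sgraph) (f : edge G) (u : G) :
  u \in val f -> exists2 w, adj u w & val f = [set u; w].
Proof.
have [x [y [xy ->]]] := edge_endpoints f.
rewrite !inE => /orP[]/eqP->; first by exists y.
by exists x; rewrite 1?adj_sym // setUC.
Qed.

Lemma edge_adj (G : sgraph) (f : edge G) (u v : G) :
  val f = [set u; v] -> adj u v.
Proof.
have [x [y [xy ->]]] := edge_endpoints f; move/eqP; rewrite set2_eq.
by case/orP=> /andP[/eqP<- /eqP<-]; rewrite // adj_sym.
Qed.

Definition edges_at (G : sgraph) (u : G) : {set edge G} :=
  [set f : edge G | u \in val f].

Lemma card_edges_at (G : sgraph) (u : G) : #|edges_at u| = deg u.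
Proof.
(* [other] sends an edge at [u] to its second endpoint, which gives the bijection with the
   neighbours of [u]. The default [u] is never reached on [edges_at u]. *)
pose other (f : edge G) := odflt u [pick w | val f == [set u; w]].
have otherK w f : val f = [set u; w] -> other f = w.
  move=> E; rewrite /other; case: pickP => [z|/(_ w)]; last by rewrite E eqxx.
  rewrite E set2_eq eqxx /= => /orP[/eqP//|/andP[/eqP<- /eqP->//]].
rewrite /deg -(card_in_imset (f := other)).
  apply: eq_card => w; rewrite inE; apply/imsetP/idP => [[f]|uw].
    by rewrite inE => /edge_at[z uz E] ->; rewrite (otherK z).
  by have [f E] := edge_exists uw; exists f; rewrite ?inE ?E ?inE ?eqxx // (otherK w).
move=> f g; rewrite !inE => /edge_at[z _ Ef] /edge_at[t _ Eg].
by rewrite (otherK z) // (otherK t) // => zt; apply: val_inj; rewrite /= Ef Eg zt.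
Qed.

(** Neighbourhoods and stars are counted by treating their vertices and their edges separately. *)
Lemma card_inl_inr (A B : finType) (X : {set A + B}) (Y : {set A}) (Z : {set B}) :
  (forall y, (inl y \in X) = (y \in Y)) -> (forall z, (inr z \in X) = (z \in Z)) ->
  #|X| = #|Y| + #|Z|.
Proof.
move=> XY XZ; rewrite -(card_imset _ (@inl_inj A B)) -(card_imset _ (@inr_inj A B)).
rewrite -cardsUI (_ : _ :&: _ = set0) ?cards0 ?addn0; last first.
  by apply/setP=> x; rewrite !inE; apply/andP=> -[/imsetP[y _ ->] /imsetP[z _]].
apply: eq_card => -[y|z]; rewrite inE.
  rewrite XY mem_imset; last exact: inl_inj.
  by case: imsetP => [[]|]; rewrite ?orbF.
rewrite XZ [in RHS]orbC mem_imset; last exact: inr_inj.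
by case: imsetP => [[]|]; rewrite ?orbF.
Qed.

Lemma total_deg_vertex (G : sgraph) (u : G) : total_deg (inl u) = (deg u).*2.
Proof.
rewrite -addnn -{2}card_edges_at /deg; apply: card_inl_inr => y; by rewrite !inE.
Qed.

(** The edges at [u] and those at [v] share only [f]. Counting [f] once and then removing it loses
    two, which the two endpoints compensate. *)
Lemma total_deg_edge (G : sgraph) (f : edge G) (u v : G) :
  val f = [set u; v] -> total_deg (inr f) = deg u + deg v.
Proof.
move=> Ef; have uv := edge_adj Ef.
rewrite /total_deg (@card_inl_inr _ _ _ [set u; v] ((edges_at u :|: edges_at v) :\ f)).
- have := cardsU (edges_at u) (edges_at v); rewrite !card_edges_at.
  have -> : edges_at u :&: edges_at v = [set f].
    apply/setP=> g; rewrite !inE; apply/andP/eqP=> [[]|->]; last by rewrite Ef !inE !eqxx orbT.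
    move=> /edge_at[w uw Eg]; rewrite Eg !inE eq_sym (negPf (adj_neq uv)) /= => /eqP vw.
    by apply: val_inj; rewrite /= Ef Eg vw.
  have := cardsD1 f (edges_at u :|: edges_at v).
  have fu : f \in edges_at u by rewrite inE Ef !inE eqxx.
  have fv : f \in edges_at v by rewrite inE Ef !inE eqxx orbT.
  have : f \in edges_at u :|: edges_at v by rewrite inE fu.
  have : 0 < deg u by rewrite -card_edges_at; apply/card_gt0P; exists f.
  have : 0 < deg v by rewrite -card_edges_at; apply/card_gt0P; exists f.
  by rewrite cards1 cards2 (adj_neq uv) => ? ? -> ? ?; lia.
- by move=> y; rewrite !inE /= Ef !inE.
move=> g; rewrite !inE /= eq_sym; congr (_ && _); rewrite Ef.
apply/set0Pn/orP => [[z]|].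
  by rewrite !inE => /andP[/orP[]/eqP->]; [left|right].
by case=> ?; [exists u | exists v]; rewrite !inE eqxx ?orbT.
Qed.

(** These elements fill the first [k] places of the non-increasing degree sequence, so its entry at
    index [k - 1] is at least [k - 1]. *)
Lemma m_t_ge (G : sgraph) (k : nat) :
  k <= #|[set x : element G | k.-1 <= total_deg x]| -> k <= m_t G.
Proof.
(* From here on [k] is the index counted from 0, one less than the bound to be proved. *)
case: k => [//|k] /= cardk; rewrite /m_t.
set s := total_deg_seq G.
have ss : size s = #|element G| by rewrite /s size_sort size_map -cardE.
have ks : k < size s.
  by rewrite ss (leq_trans cardk) // max_card.
have cnt : k < count (leq k) s.
  rewrite /s /total_deg_seq count_sort count_map (leq_trans cardk) // -size_filter.
  rewrite cardE enumT /enum_mem size_filter [leqRHS]size_filter.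
  by apply: sub_count => x /=; rewrite inE.
apply: (bigmax_sup (Ordinal ks)) => //=.
(* If the entry at index [k] were below [k], so would all later ones be, and at most [k] entries
   could reach [k]. *)
rewrite leqNgt; apply/negP=> lt; move: cnt; rewrite -(cat_take_drop k s) count_cat ltnNge.
rewrite (_ : count _ (drop k s) = 0) ?addn0.
  by rewrite (leq_trans (count_size _ _)) // size_take ks.
apply/eqP; rewrite -leqn0 leqNgt -has_count; apply/hasPn => x /(nthP 0)[i].
rewrite size_drop nth_drop => ik <-; rewrite -ltnNge (leq_ltn_trans _ lt) //.
have geq_trans : transitive geq by move=> a b d ab bd; apply: leq_trans bd ab.
have s_sorted : sorted geq s by apply: sort_sorted => a b; apply: leq_total.
by apply: (sorted_leq_nth geq_trans leqnn 0 s_sorted); rewrite ?inE ?leq_addr -?ltn_subRL.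
Qed.

(** * Greedy extension of partial colourings *)

(** Induction on the number of uncoloured elements: one with fewer than [k] neighbours always has a
    free colour. *)
Lemma extend_colouring (G : sgraph) (k : nat) (S : {set element G})
    (c : element G -> 'I_k) :
  {in S &, forall x y, tadj x y -> c x != c y} ->
  (forall x, x \notin S -> total_deg x < k) ->
  exists c' : element G -> 'I_k,
    {in S, c' =1 c} /\ forall x y, tadj x y -> c' x != c' y.
Proof.
elim: {S}#|~: S| {-2}S (leqnn #|~: S|) c => [|n IHn] S Sn c proper low;
  case: (pickP [predC S]) => [x /= xS | allS];
  try by exists c; split=> // x y; apply: proper;
    [have := allS x | have := allS y] => /= /negbFE.
- by move: Sn; rewrite leqn0 cards_eq0 => /eqP/setP/(_ x); rewrite !inE xS.
(* The values of [c] at neighbours outside [S] are avoided too; this is harmless, since the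
   neighbours are fewer than [k] altogether. *)
- have [i iN] : exists i, i \notin [set c y | y in total_nbh x].
    apply/existsP; rewrite -negb_forall; apply/negP=> /forallP all_in.
    have := low x xS; rewrite ltnNge => /negP; apply.
    rewrite -[k]card_ord (leq_trans _ (leq_imset_card c _)) //.
    by rewrite subset_leq_card //; apply/subsetP=> i _; rewrite all_in.
  pose c1 y := if y == x then i else c y.
  have c1x : c1 x = i by rewrite /c1 eqxx.
  have c1S y : y \in S -> c1 y = c y.
    by rewrite /c1; case: eqP => // -> xS'; rewrite xS' in xS.
  have c1P y : y \in S -> tadj x y -> i != c1 y.
    move=> yS xy; rewrite c1S //; apply/eqP=> E; case/negP: iN; rewrite E.
    by apply: imset_f; rewrite inE.
  have [||| c' [c'c c'P]] := IHn (x |: S) _ c1.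
  + rewrite -ltnS (leq_trans _ Sn) // [leqRHS](cardsD1 x) inE xS add1n ltnS.
    by rewrite subset_leq_card //; apply/subsetP=> y; rewrite !inE negb_or.
  + move=> y z /setU1P[->|yS] /setU1P[->|zS] yz.
    * by rewrite tadj_irrefl in yz.
    * by rewrite c1x c1P.
    * by rewrite eq_sym c1x c1P // tadj_sym.
    * by rewrite !c1S // proper.
  + by move=> y; rewrite in_setU1 negb_or => /andP[_]; apply: low.
  by exists c'; split=> // y yS; rewrite c'c ?c1S // in_setU1 yS orbT.
Qed.

(* [S] is the set of precoloured elements, and the witnesses of [b_chromatic]
   are already b-chromatic in the partial colouring. *)
Lemma extend_b_colouring (G : sgraph) (k : nat) (S : {set element G})
    (c : element G -> 'I_k) :
  {in S &, forall x y, tadj x y -> c x != c y} ->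
  (forall x, x \notin S -> total_deg x < k) ->
  (forall i, exists x, [/\ x \in S, c x = i &
     forall j, j != i -> exists y, [/\ y \in S, tadj x y & c y = j]]) ->
  exists c' : {ffun element G -> 'I_k}, total_b_colouring c'.
Proof.
move=> proper low reps.
have [c' [c'c c'P]] := extend_colouring proper low.
exists [ffun x => c' x]; apply/andP; split; [apply/andP; split|].
- apply/forallP=> i; have [x [xS <- _]] := reps i.
  by apply/existsP; exists x; rewrite ffunE c'c.
- by apply/'forall_forallP=> x y; apply/implyP=> /c'P; rewrite !ffunE.
apply/forallP=> i; have [x [xS cx see]] := reps i.
apply/existsP; exists x; rewrite ffunE c'c // cx eqxx /=.
apply/forallP=> j; apply/implyP; rewrite ffunE c'c // cx => /see[y [yS xy cy]].
by apply/existsP; exists y; rewrite inE xy ffunE c'c // cy /=.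
Qed.

(** * Upper bounds obtained from b-chromatic elements *)

Lemma b_chromatic_degree (G : sgraph) (k : nat) (c : {ffun element G -> 'I_k})
    (x : element G) :
  total_b_chromatic c x -> k.-1 <= total_deg x.
Proof.
move=> /forallP cx; rewrite -[k]card_ord -(cardC1 (c x)).
rewrite (leq_trans _ (leq_imset_card c _)) // subset_leq_card //.
apply/subsetP=> i; rewrite !inE => ix.
have /existsP[y /andP[xy /eqP <-]] := implyP (cx i) ix.
exact: imset_f.
Qed.

(** With [c] as a left inverse, the chosen representatives are distinct and can be counted. *)
Lemma b_colouring_reps (G : sgraph) (k : nat) (c : {ffun element G -> 'I_k}) :
  total_b_colouring c ->
  exists2 r : 'I_k -> element G,
    cancel r c & forall i, total_b_chromatic c (r i).
Proof.
case/andP=> _ /forallP reps.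
exists (fun i => xchoose (existsP (reps i))) => i;
  by case/andP: (xchooseP (existsP (reps i))) => /eqP.
Qed.

Lemma b_colouring_le_m_t (G : sgraph) (k : nat) (c : {ffun element G -> 'I_k}) :
  total_b_colouring c -> k <= m_t G.
Proof.
case/b_colouring_reps=> r rK rP; apply: m_t_ge.
rewrite -[leqLHS]card_ord -(card_imset _ (can_inj rK)) subset_leq_card //.
by apply/subsetP=> _ /imsetP[i _ ->]; rewrite inE (b_chromatic_degree (rP i)).
Qed.

(* The b-chromatic representatives of the [m_t G] colours are total dense, hence
   they exhaust the total dense elements. *)
Lemma dense_b_chromatic (G : sgraph) (c : {ffun element G -> 'I_(m_t G)}) :
  #|[set x : element G | total_dense x]| = m_t G ->
  total_b_colouring c ->
  (forall x, total_dense x -> total_b_chromatic c x) /\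
  (forall x y, total_dense x -> total_dense y -> c x = c y -> x = y).
Proof.
move=> cardD /b_colouring_reps[r rK rP].
have denseP x : total_dense x -> exists i, x = r i.
  have /eqP E : [set r i | i in 'I_(m_t G)] == [set x | total_dense x].
    rewrite eqEcard cardD card_imset ?card_ord ?leqnn ?andbT; last exact: can_inj rK.
    apply/subsetP=> _ /imsetP[i _ ->].
    by rewrite inE /total_dense subn1 (b_chromatic_degree (rP i)).
  move=> xD; have : x \in [set r i | i in 'I_(m_t G)] by rewrite E inE.
  by case/imsetP=> i _ ->; exists i.
split=> [x /denseP[i ->] //|x y /denseP[i ->] /denseP[j ->]].
by rewrite !rK => ->.
Qed.

Lemma b_chromatic_sees (G : sgraph) (k : nat) (c : {ffun element G -> 'I_k})
    (x y : element G) :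
  total_b_chromatic c x -> c y != c x -> exists2 z, tadj x z & c z = c y.
Proof.
move=> /forallP/(_ (c y))/implyP cx /cx /existsP[z].
by rewrite inE => /andP[xz /eqP]; exists z.
Qed.

(** No colouring of this kind uses more than [m_t G] colours, so once [m_t G] is excluded the next
    value is the maximum. *)
Lemma phi_t_pivot (G : sgraph) :
  (exists c : {ffun element G -> 'I_(m_t G - 1)}, total_b_colouring c) ->
  (forall c : {ffun element G -> 'I_(m_t G)}, ~~ total_b_colouring c) ->
  phi_t G = m_t G - 1.
Proof.
move=> has_low no_m; apply/eqP; rewrite eqn_leq; apply/andP; split.
  apply/bigmax_leqP=> -[k /= _] /existsP[c cP].
  have : k <= m_t G := b_colouring_le_m_t cP.
  rewrite leq_eqVlt => /orP[/eqP E|]; last by lia.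
  by move: c cP; rewrite E => c cP; have := no_m c; rewrite cP.
by apply: phi_t_max; apply/existsP.
Qed.

(** * Caterpillars of type 1 *)

Lemma acyclic_triangle_free (G : sgraph) (x y z : G) :
  acyclic G -> adj x y -> adj y z -> adj z x = false.
Proof.
move=> acyc xy yz; apply/negP=> zx.
have /acyc : cycle adj [:: x; y; z] by rewrite /= xy yz zx.
by rewrite /= !inE negb_or (adj_neq xy) (adj_neq yz) eq_sym (adj_neq zx) /= => /(_ isT).
Qed.

(** A clique for [tadj]. In type 1 it has [m_t G - 1] members, one to represent each colour. *)
Definition star (G : sgraph) (u : G) : {set element G} :=
  [set x : element G | match x with inl v => v == u | inr f => u \in val f end].

Lemma star_clique (G : sgraph) (u : G) :
  {in star u &, forall x y, tadj x y = (x != y)}.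
Proof.
move=> [v|f] [w|g]; rewrite !inE //=.
- by move=> /eqP-> /eqP->; rewrite adj_irrefl eqxx.
- by move=> /eqP-> ->.
- by move=> uf /eqP->; rewrite uf.
move=> uf ug; rewrite (_ : _ != set0) ?andbT //.
by apply/set0Pn; exists u; rewrite inE uf.
Qed.

Lemma card_star (G : sgraph) (u : G) : #|star u| = (deg u).+1.
Proof.
rewrite (@card_inl_inr _ _ _ [set u] (edges_at u)) ?cards1 ?card_edges_at //.
by move=> y; rewrite !inE.
by move=> y; rewrite !inE.
Qed.

(** An edge at [u] has total degree at least [(m - 2) + 1], hence is dense. With [u] and [v] this
    makes [m] dense elements, so there are no others. *)
Lemma type1_dense (G : sgraph) (u v : G) :
  6 <= m_t G -> #|[set x : element G | total_dense x]| = m_t G ->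
  deg u = m_t G - 2 -> total_dense (inl u : element G) ->
  total_dense (inl v : element G) -> v != u ->
  [set x | total_dense x] = inl v |: star u.
Proof.
move=> m6 cardD du uD vD vu; apply/eqP; rewrite eq_sym eqEcard cardD.
rewrite cardsU1 card_star du !inE (negPf vu) andbC; apply/andP; split; first lia.
apply/subsetP=> -[w|f]; rewrite !inE.
  by case/orP=> [/eqP[->]|/eqP->].
move=> /= /edge_at[w uw Ef]; rewrite /total_dense (total_deg_edge Ef).
have : 0 < deg w by apply/card_gt0P; exists u; rewrite inE adj_sym.
lia.
Qed.

Lemma type1_has_colouring (G : sgraph) (u v : G) :
  6 <= m_t G -> deg u = m_t G - 2 -> v != u -> ~~ adj u v ->
  [set x : element G | total_dense x] = inl v |: star u ->
  exists c : {ffun element G -> 'I_(m_t G - 1)}, total_b_colouring c.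
Proof.
move=> m6 du vu nuv denseE.
(* The members of the star serve as the colours, through their rank in it. *)
have <- : #|star u| = m_t G - 1 by rewrite card_star du; lia.
have uS : inl u \in star u by rewrite inE.
(* The vertex [v] takes the colour of [u]; it is adjacent to nothing in the star, because [u] and
   [v] are not neighbours. *)
pose h (x : element G) := if x == inl v then inl u else x.
have vS : inl v \notin star u by rewrite inE.
have hS x : x \in star u -> h x = x.
  by rewrite /h; case: eqP => // -> vS'; rewrite vS' in vS.
have v_isolated x : x \in star u -> tadj (inl v) x = false.
  case: x => [w|f]; rewrite inE /=; first by move=> /eqP->; rewrite adj_sym (negPf nuv).
  move=> /edge_at[w uw ->]; rewrite !inE (negPf vu) /=.
  by apply: contraNF nuv => /eqP->.
apply: (@extend_b_colouring _ _ (inl v |: star u) (fun x => enum_rank_in uS (h x))).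
- move=> x y /setU1P[->|xS] /setU1P[->|yS]; rewrite ?tadj_irrefl //.
  + by rewrite v_isolated.
  + by rewrite tadj_sym v_isolated.
  rewrite !hS // (star_clique xS yS); apply: contraNneq => E.
  by rewrite -(enum_rankK_in uS xS) E enum_rankK_in.
- move=> x; rewrite -denseE inE /total_dense card_star du; lia.
move=> i; have iS j : enum_val j \in star u := enum_valP j.
exists (enum_val i); split; rewrite ?in_setU1 ?iS ?orbT // ?hS ?enum_valK_in //.
move=> j ji; exists (enum_val j).
rewrite in_setU1 iS orbT hS // enum_valK_in; split=> //.
by rewrite (star_clique (iS i) (iS j)) (inj_eq enum_val_inj) eq_sym.
Qed.

Lemma type1_no_m_colouring (G : sgraph) (u u' v : G)
    (c : {ffun element G -> 'I_(m_t G)}) :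
  #|[set x : element G | total_dense x]| = m_t G ->
  adj u u' -> deg u' = 2 -> adj u' v -> v != u ->
  [set x : element G | total_dense x] = inl v |: star u ->
  ~~ total_b_colouring c.
Proof.
move=> cardD uu' du' u'v vu denseE; apply/negP=> cP.
have [cb cinj] := dense_b_chromatic cardD cP.
have proper x y : tadj x y -> c x <> c y.
  case/andP: cP => /andP[_ /'forall_forallP P] _ xy; apply/eqP.
  exact: (implyP (P x y)).
have denseP x : total_dense x = (x \in inl v |: star u) by rewrite -denseE inE.
have vD : total_dense (inl v : element G) by rewrite denseP setU11.
have starD x : x \in star u -> total_dense x.
  by move=> xS; rewrite denseP in_setU1 xS orbT.
have v_star x : x \in star u -> c x <> c (inl v).
  move=> xS /(cinj _ _ (starD x xS) vD) xv; rewrite xv in xS; move: xS.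
  by rewrite inE (negPf vu).
have [e Ee] := edge_exists uu'; have [e' Ee'] := edge_exists u'v.
have eS : inr e \in star u by rewrite inE Ee !inE eqxx.
(* The b-chromatic edge [e] meets the colour of [v] on some [z], which lies outside the star because
   no colour there is that of [v]. *)
have [|z ez cz] := @b_chromatic_sees _ _ c (inr e) (inl v) (cb _ (starD _ eS)).
  by apply/eqP=> E; apply: (v_star _ eS).
have zS : z \notin star u by apply/negP=> /v_star.
have nbrE : [set u; v] = [set w | adj u' w].
  apply/eqP; rewrite eqEcard cards2 eq_sym vu -/(deg u') du' andbT.
  by apply/subsetP=> x; rewrite !inE => /orP[]/eqP->; rewrite // adj_sym.
have nbr_u' w : adj u' w -> (w == u) || (w == v).
  by move=> u'w; rewrite -in_set2 nbrE inE.
case: z => [w|f] /= in ez cz zS *.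
  move: ez zS; rewrite Ee !inE => /orP[->//|/eqP w_u' _].
  by apply: (proper (inl w) (inl v)) => //=; rewrite w_u'.
(* An edge [z] meeting [e] at [u] is in the star. If it meets [e] at [u'], its other end is [u],
   again in the star, or [v], to which it is then adjacent. *)
case/andP: ez => _ /set0Pn[w]; rewrite inE Ee !inE => /andP[/orP[]/eqP-> wf].
  by rewrite inE wf in zS.
have [x /nbr_u' xE Ef] := edge_at wf; apply: (proper (inr f) (inl v)) => //=.
case/orP: xE => /eqP xE.
  by rewrite inE Ef xE !inE eqxx orbT in zS.
by rewrite Ef xE !inE eqxx orbT.
Qed.

(** * Total dense paths *)

(** Rewriting with this family reduces comparisons inside explicit lists of elements to comparisons
    of vertices and of endpoint sets. *)
Lemma element_eqE (G : sgraph) :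
  ((forall u v : G, (inl u == inl v :> element G) = (u == v)) *
   (forall f g : edge G, (inr f == inr g :> element G) = (val f == val g)) *
   (forall (u : G) (g : edge G), (inl u == inr g :> element G) = false) *
   (forall (f : edge G) (v : G), (inr f == inl v :> element G) = false))%type.
Proof. by []. Qed.

Lemma on_path1 (G : sgraph) (a : G) (f : edge G) : on_path [:: a] (inr f) = false.
Proof. by apply/existsP=> -[u /existsP[v /=]]; rewrite !andbF. Qed.

Lemma on_path_cons2 (G : sgraph) (a b : G) (p : seq G) (f : edge G) :
  on_path (a :: b :: p) (inr f) = (val f == [set a; b]) || on_path (b :: p) (inr f).
Proof.
apply/'exists_existsP/orP => [[u [v]]|[E|/'exists_existsP[u [v /andP[uv E]]]]].
- rewrite infix_consl !prefix_cons prefix0s andbT => /andP[/orP[/andP[/eqP<- /eqP<-]|uv] E].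
    by left.
  by right; apply/'exists_existsP; exists u, v; rewrite uv.
- by exists a, b; rewrite E infix_consl !prefix_cons prefix0s !eqxx.
by exists u, v; rewrite E infix_consl uv orbT.
Qed.

Lemma on_path_rev (G : sgraph) (p : seq G) (x : element G) :
  on_path (rev p) x = on_path p x.
Proof.
case: x => [v|f] /=; first by rewrite mem_rev.
apply/'exists_existsP/'exists_existsP => -[u [v /andP[uv E]]]; exists v, u;
  by rewrite -infix_rev ?revK {1}/rev /= uv setUC.
Qed.

Lemma same_path_on_path (G : sgraph) (p q : seq G) (x : element G) :
  same_path p q -> on_path p x = on_path q x.
Proof. by case/orP=> /eqP->; rewrite ?on_path_rev. Qed.

Lemma total_dense_on_rev (G : sgraph) (p : seq G) :
  total_dense_on (rev p) = total_dense_on p.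
Proof. by apply/setP=> x; rewrite !inE on_path_rev. Qed.

Lemma total_dense_path_rev (G : sgraph) (p : seq G) :
  total_dense_path p -> total_dense_path (rev p).
Proof.
case=> /and3P[p0 ps pu] pv pe [x px xD]; split.
- apply/and3P; split; rewrite ?rev_uniq //.
    by rewrite -size_eq0 size_rev size_eq0.
  by rewrite rev_sorted (eq_sorted (e' := adj)) // => u v; rewrite adj_sym.
- by move=> u v w uvw; apply: (pv w v u); rewrite -infix_rev {1}/rev.
- by move=> f; rewrite on_path_rev; apply: pe.
by exists x; rewrite ?on_path_rev.
Qed.

Lemma on_path_infix (G : sgraph) (p q : seq G) (x : element G) :
  infix p q -> on_path p x -> on_path q x.
Proof.
move=> pq; case: x => [v|f] /=; first exact: mem_infix.
case/'exists_existsP=> u [v /andP[uv E]]; apply/'exists_existsP; exists u, v.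
by rewrite (infix_trans uv pq) E.
Qed.

(** A dense vertex is a one-vertex path, and a dense edge is the path of its two ends; neither has
    an interior vertex. *)
Lemma dense_on_some_path (G : sgraph) (x : element G) :
  total_dense x -> exists2 p, total_dense_path p & on_path p x.
Proof.
move=> xD; case: x xD => [v|f] xD.
  exists [:: v]; rewrite /= ?mem_head //; split=> //.
  - by move=> u1 u2 u3 /=; rewrite !andbF.
  - by move=> f; rewrite on_path1.
  by exists (inl v); rewrite //= mem_head.
have [u [v [uv E]]] := edge_endpoints f.
have fp : on_path [:: u; v] (inr f) by rewrite on_path_cons2 E eqxx.
exists [:: u; v] => //; split.
- by rewrite /gpath /= uv inE (adj_neq uv).
- by move=> u1 u2 u3 /=; rewrite !andbF.
- move=> g; rewrite on_path_cons2 on_path1 orbF => /eqP Eg.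
  by rewrite (_ : g = f) //; apply: val_inj; rewrite /= Eg E.
by exists (inr f).
Qed.

(** A dense path through [x] that cannot be prolonged is maximal, hence one of the two given paths
    up to reversal. *)
Lemma dense_on_maximal_path (G : sgraph) (p1 p2 : seq G) (x : element G) :
  (forall p : seq G, maximal_total_dense_path p -> same_path p p1 || same_path p p2) ->
  total_dense x -> (x \in total_dense_on p1) || (x \in total_dense_on p2).
Proof.
move=> maxE xD; apply: contraT => xN; have [p pP px] := dense_on_some_path xD.
(* Here [n] bounds the room left for prolonging [p]: a proper extension is longer and needs a
   smaller [n], while at 0 the path would have more than [#|G|] vertices. *)
suff no_path : forall n (p : seq G), total_dense_path p -> on_path p x ->
    #|G| < size p + n -> False.
  by case: (no_path #|G|.+1 p pP px); lia.
elim=> {p pP px} [|n IHn] p pP px.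
  case: pP => /and3P[_ _ pu] _ _ _; rewrite addn0 -(card_uniqP pu).
  by rewrite ltnNge max_card.
move=> pn; move: xN; rewrite !inE xD !andbT negb_or.
have /maxE : maximal_total_dense_path p.
  split=> // q qP pq; apply/eqP; apply: contraT => qp; exfalso.
  apply: (IHn q qP (on_path_infix pq px)).
  have := pq; case/infixP=> s1 [s2 qE]; move: qp; rewrite qE => qp.
  have : 0 < size s1 + size s2.
    case: s1 s2 qE qp => [|? ?] [|? ?] _ //=; rewrite ?addnS //.
    by rewrite cats0 eqxx.
  move=> pos; apply: leq_trans pn _; rewrite !size_cat addnS -addSn leq_add2r.
  by rewrite addnCA -addn1 leq_add2l.
by case/orP=> /same_path_on_path <-; rewrite px ?andbF.
Qed.

(** * Paths with three total dense elements, and the arms at their ends *)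

(** The number of dense elements forces exactly three vertices: one or two vertices give at most two
    dense elements when [x] is not dense, and four or more give at least four. *)
Lemma three_dense_path (G : sgraph) (p : seq G) (x : G) :
  total_dense_path (rcons p x) -> #|total_dense_on (rcons p x)| = 3 ->
  ~~ total_dense (inl x : element G) ->
  exists a b ab bx,
    [/\ val ab = [set a; b], val bx = [set b; x], a != x,
        ~~ total_dense (inl a : element G) &
        {subset total_dense_on (rcons p x) <=
           [:: inl b; inr ab; inr bx : element G]}].
Proof.
move=> [/and3P[_ ps pu] pv pe _] card3 xN.
have le_card (s : seq (element G)) :
    uniq s -> {subset s <= total_dense_on (rcons p x)} -> size s <= 3.
  move=> us sp; rewrite -card3 -(card_uniqP us) subset_leq_card //.
  exact/subsetP.
have ge_card (s : seq (element G)) :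
    {subset total_dense_on (rcons p x) <= s} -> 3 <= size s.
  move=> sp; rewrite -card3; apply: leq_trans (card_size s).
  by rewrite subset_leq_card //; apply/subsetP.
case: p => [|a [|b [|c p]]] in ps pu pv pe card3 le_card ge_card *;
  rewrite [rcons _ _]/= in ps pu pv pe card3 le_card ge_card *;
  rewrite /= in ps pu.
- suff /ge_card : {subset total_dense_on [:: x] <= [::]} by [].
  move=> [v|f]; rewrite inE ?on_path1 //= inE => /andP[/eqP->].
  by rewrite (negPf xN).
- have /edge_exists[e Ee] : adj a x by case/andP: ps.
  suff /ge_card : {subset total_dense_on [:: a; x] <= [:: inl a; inr e]} by [].
  move=> [v|f]; rewrite inE ?on_path_cons2 ?on_path1 ?orbF /=.
    rewrite !inE => /andP[/orP[]/eqP->]; last by rewrite (negPf xN).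
    by rewrite eqxx.
  case/andP=> /eqP Ef _; rewrite !inE (_ : f = e) ?eqxx ?orbT //.
  by apply: val_inj; rewrite /= Ee Ef.
- case/and3P: ps => [/edge_exists[ab Eab] /edge_exists[bx Ebx] _].
  have ax : a != x by move: pu; rewrite !inE negb_or => /and3P[/andP[]].
  (* A dense [a] would be a fourth dense element beside [b], [ab] and [bx]. *)
  have aN : ~~ total_dense (inl a : element G).
    apply/negP=> aD.
    have bD : total_dense (inl b : element G).
      by apply: (pv a b x); rewrite /= !eqxx.
    have abp : on_path [:: a; b; x] (inr ab) by rewrite on_path_cons2 Eab eqxx.
    have bxp : on_path [:: a; b; x] (inr bx) by rewrite !on_path_cons2 Ebx eqxx orbT.
    suff /le_card : uniq [:: inl a; inl b; inr ab; inr bx : element G].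
      suff sub : {subset [:: inl a; inl b; inr ab; inr bx]
                    <= total_dense_on [:: a; b; x]} by move/(_ sub).
      move=> z; rewrite !inE => /or4P[]/eqP->; rewrite ?abp ?bxp ?pe ?aD ?bD //=;
      by rewrite !inE eqxx ?orbT.
    rewrite !cons_uniq !in_cons !in_nil !element_eqE Eab Ebx set2_eq (negPf ax).
    by rewrite (negPf (adj_neq (edge_adj Eab))).
  exists a, b, ab, bx; split=> //.
  move=> [v|f]; rewrite inE ?on_path_cons2 ?on_path1 ?orbF /= => /andP[].
    by rewrite !inE => /or3P[]/eqP-> vD; rewrite ?eqxx // ?(negPf xN) ?(negPf aN) in vD *.
  rewrite -Eab -Ebx => /orP[]/eqP/val_inj-> _; by rewrite !inE eqxx ?orbT.
(* With at least four vertices, [b] and [c] are interior, so [b], [c], [ab] and [bc] are all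
   dense. *)
case/and3P: ps => [/edge_exists[ab Eab] /edge_exists[bc Ebc] _].
have [ab_neq ac_neq bc_neq] : [/\ a != b, a != c & b != c].
  by move: pu; rewrite !inE !negb_or => /andP[/and3P[-> -> _] /andP[/andP[->]]].
suff /le_card : uniq [:: inl b; inl c; inr ab; inr bc : element G].
  suff sub : {subset [:: inl b; inl c; inr ab; inr bc]
                <= total_dense_on [:: a, b, c & rcons p x]} by move/(_ sub).
  move=> z; rewrite !inE => /or4P[]/eqP->.
  - rewrite /= !inE eqxx ?orbT (pv a b c) //.
    by rewrite infix_consl !prefix_cons prefix0s !eqxx.
  (* The vertex after [c] is the head of [p], or [x] if [p] is empty. *)
  - rewrite /= !inE eqxx ?orbT (pv b c (head x p)) //.
    by rewrite headI !infix_consl !prefix_cons !prefix0s !eqxx /= ?orbT.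
  - have abp : on_path [:: a, b, c & rcons p x] (inr ab).
      by rewrite on_path_cons2 Eab eqxx.
    by rewrite abp pe.
  have bcp : on_path [:: a, b, c & rcons p x] (inr bc).
    by rewrite !on_path_cons2 Ebc eqxx orbT.
  by rewrite bcp pe.
rewrite !cons_uniq !in_cons !in_nil !element_eqE Eab Ebc set2_eq.
by rewrite (negPf ab_neq) (negPf ac_neq) (negPf bc_neq).
Qed.

(* The neighbourhood of an edge [bx] with [deg b = 3] and [deg x = 2]: the
   remaining edges at [b] are [ab], [bw], and the one at [x] is [xz]. *)
Record arm (G : sgraph) (a b x w z : G) (ab bx bw xz : edge G) : Prop := Arm {
  arm_ab : val ab = [set a; b];
  arm_bx : val bx = [set b; x];
  arm_bw : val bw = [set b; w];
  arm_xz : val xz = [set x; z];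
  arm_neq : [&& a != x, a != w, x != w & b != z];
  arm_nbr_b : forall t, adj b t -> [|| t == a, t == x | t == w];
  arm_nbr_x : forall t, adj x t -> (t == b) || (t == z)
}.

Lemma arm_tadj (G : sgraph) (a b x w z : G) (ab bx bw xz : edge G) (t : element G) :
  arm a b x w z ab bx bw xz -> tadj (inr bx) t ->
  t \in [:: inl b; inl x; inr ab; inr bw; inr xz].
Proof.
move=> [Eab Ebx Ebw Exz _ nb nx]; rewrite !inE; case: t => [t|f].
  by rewrite /= !element_eqE Ebx !inE orbF.
rewrite /= !element_eqE -val_eqE /= Ebx Eab Ebw Exz.
case/andP=> bxf /set0Pn[t]; rewrite !inE => /andP[/orP[]/eqP-> /edge_at[s ts Ef]].
  case/or3P: (nb s ts) Ef => /eqP-> Ef; rewrite Ef in bxf *; rewrite ?eqxx ?orbT //.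
    by rewrite setUC eqxx.
  by rewrite eqxx in bxf.
case/orP: (nx s ts) Ef => /eqP-> Ef; rewrite Ef in bxf *; rewrite ?eqxx ?orbT //.
by rewrite setUC eqxx in bxf.
Qed.

Lemma deg_neighbours (G : sgraph) (u : G) (s : seq G) :
  uniq s -> all (adj u) s -> size s = deg u -> forall t, adj u t -> t \in s.
Proof.
move=> us /allP adjs sz t ut.
have /subset_cardP/(_ _) E : #|s| = #|[set w | adj u w]| by rewrite (card_uniqP us) sz.
rewrite E ?inE //; apply/subsetP=> w /adjs; by rewrite inE.
Qed.

(** The bounds give [deg b >= 3] and [deg x <= 2], so [b] has a third neighbour [w]. As [bw] is not
    dense, [deg b + deg w <= 4], whence [deg b = 3], and density of [bx] then gives [deg x = 2]. *)
Lemma arm_exists (G : sgraph) (a b x z : G) (ab bx : edge G) :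
  val ab = [set a; b] -> val bx = [set b; x] -> a != x -> z != b -> adj x z ->
  5 <= total_deg (inl b) -> 5 <= total_deg (inr bx) -> total_deg (inl x) <= 4 ->
  (forall f : edge G, b \in val f -> 5 <= total_deg (inr f) -> f = ab \/ f = bx) ->
  exists w bw xz, arm a b x w z ab bx bw xz.
Proof.
move=> Eab Ebx ax zb xz; rewrite !total_deg_vertex (total_deg_edge Ebx).
move=> degb degbx degx only.
have ba : adj b a by rewrite adj_sym (edge_adj Eab).
have bx' : adj b x := edge_adj Ebx.
have [w] : exists w, w \in [set t | adj b t] :\: [set a; x].
  apply/card_gt0P; rewrite cardsD subn_gt0.
  rewrite (leq_ltn_trans (subset_leq_card (subsetIr _ _))) // cards2 ax -/(deg b).
  by lia.
rewrite !inE negb_or => /andP[/andP[wa wx] bw'].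
have [bw Ebw] := edge_exists bw'; have [e Exz] := edge_exists xz.
have degw : 0 < deg w by apply/card_gt0P; exists b; rewrite inE adj_sym.
have : ~~ (5 <= total_deg (inr bw)).
  apply/negP=> /only []; first by rewrite Ebw !inE eqxx.
    move/(congr1 val)/eqP; rewrite Ebw Eab set2_eq (negPf wa) andbF orbF.
    by rewrite (negPf (adj_neq ba)).
  move/(congr1 val)/eqP; rewrite Ebw Ebx set2_eq (negPf wx) andbF /=.
  by rewrite (negPf (adj_neq bx')).
rewrite (total_deg_edge Ebw) => degbw.
have degb3 : deg b = 3 by lia.
have degx2 : deg x = 2 by lia.
exists w, bw, e; split=> //.
- by rewrite ax (eq_sym a) wa (eq_sym x) wx eq_sym zb.
- move=> t /(@deg_neighbours _ b [:: a; x; w]); rewrite !inE; apply.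
  + by rewrite /= !inE negb_or ax (eq_sym a) wa (eq_sym x) wx.
  + by rewrite /= ba bx' bw'.
  + by rewrite degb3.
move=> t /(@deg_neighbours _ x [:: b; z]); rewrite !inE; apply.
+ by rewrite /= inE eq_sym zb.
+ by rewrite /= adj_sym bx' xz.
by rewrite degx2.
Qed.

(** Partial colourings are given below as lists of disjoint colour classes, the colour being the
    index of the class. *)
Lemma find_uniq_flatten (A : eqType) (L : seq (seq A)) (i : nat) (t : A) :
  uniq (flatten L) -> t \in nth [::] L i -> find (fun C => t \in C) L = i.
Proof.
elim: L i => [|C L IHL] [|i] //= ; rewrite cat_uniq => /and3P[_ dis uL] tC.
  by rewrite tC.
case: ifP => tC'; last by rewrite (IHL i).
case/hasP: dis; exists t => //; apply/flattenP; exists (nth [::] L i) => //.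
by rewrite mem_nth // ltnNge; apply/negP=> sz; rewrite nth_default in tC.
Qed.

(* The edges [ab], [bx], [bw] and the vertex [b] are pairwise adjacent, and the
   fifth colour is the one of [a], [x], [w]; the vertex [x] sees the colours of
   [ab] and [bw] through [xz] and [z]. *)
Lemma arm_colouring (G : sgraph) (a b x w z : G) (ab bx bw xz : edge G)
    (L : seq (seq (element G))) :
  arm a b x w z ab bx bw xz -> size L = 5 -> uniq (flatten L) ->
  all (pairwise (fun s t => ~~ tadj s t)) L ->
  (forall t, t \notin flatten L -> total_deg t < 5) ->
  inl b \in nth [::] L 0 ->
  {subset [:: inr ab; inr xz] <= nth [::] L 1} ->
  inr bx \in nth [::] L 2 ->
  {subset [:: inr bw; inl z] <= nth [::] L 3} ->
  {subset [:: inl a; inl x; inl w] <= nth [::] L 4} ->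
  exists c : {ffun element G -> 'I_5}, total_b_colouring c.
Proof.
move=> [Eab Ebx Ebw Exz /and4P[ax aw xw bz] _ _] L5 uL /allP indep low L0 L1 L2 L3 L4.
(* Outside [flatten L] the index found is 5, which [inord] turns into 0; such elements are not
   precoloured. *)
pose c t : 'I_5 := inord (find (fun C => t \in C) L).
have cP (i : 'I_5) t : t \in nth [::] L i -> t \in flatten L /\ c t = i.
  move=> ti; split; last by rewrite /c (find_uniq_flatten uL ti) inord_val.
  by apply/flattenP; exists (nth [::] L i); rewrite // mem_nth // L5.
have memL t : t \in flatten L -> t \in nth [::] L (c t).
  case/flattenP=> C CL tC; have hasC : has (fun C => t \in C) L by apply/hasP; exists C.
  rewrite /c inordK; last by rewrite -L5 -has_find.
  exact: (nth_find [::] hasC).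
apply: (@extend_b_colouring _ _ [set t in flatten L] c).
- move=> s t; rewrite !inE => /memL sL /memL tL; apply: contraTneq => E.
  rewrite -E in tL; set C := nth _ _ _ in sL tL.
  have /indep : C \in L by rewrite mem_nth // L5.
  rewrite pairwise_all2rel; first by move/allrelP; apply.
    by move=> y; rewrite tadj_irrefl.
  by move=> y y'; rewrite tadj_sym.
- by move=> t; rewrite inE => /low.
pose rep := [:: inl b; inr ab; inr bx; inr bw; inl x : element G].
(* Entry [j] of row [i] has colour [j]. It is the representative itself when [i = j], and otherwise
   a neighbour of the representative of colour [i]. *)
pose see : seq (seq (element G)) :=
  [:: [:: inl b; inr ab; inr bx; inr bw; inl w];
      [:: inl b; inr ab; inr bx; inr bw; inl a];
      [:: inl b; inr ab; inr bx; inr bw; inl x];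
      [:: inl b; inr ab; inr bx; inr bw; inl w];
      [:: inl b; inr xz; inr bx; inl z; inl x]].
have seeL (i j : 'I_5) : nth (inl b) (nth [::] see i) j \in nth [::] L j.
  by case: i j => [[|[|[|[|[|//]]]]] ?] [[|[|[|[|[|//]]]]] ?] //=;
     rewrite ?L1 ?L3 ?L4 // !inE eqxx ?orbT.
have repE (i : 'I_5) : nth (inl b) rep i = nth (inl b) (nth [::] see i) i.
  by case: i => [[|[|[|[|[|//]]]]] ?].
move=> i; exists (nth (inl b) rep i); rewrite inE repE.
have [-> ->] := cP i _ (seeL i i); split=> // j ji.
have [jL cj] := cP j _ (seeL i j).
exists (nth (inl b) (nth [::] see i) j); split; rewrite ?inE // -repE.
have ba : b != a by rewrite eq_sym (adj_neq (edge_adj Eab)).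
have bx' : b != x := adj_neq (edge_adj Ebx).
have bw' : b != w := adj_neq (edge_adj Ebw).
have axz := edge_adj Exz; have abw := edge_adj Ebw; have abx := edge_adj Ebx.
have axb : adj x b by rewrite adj_sym.
have Nab_bx : ab != bx.
  by rewrite -(inj_eq val_inj) Eab Ebx set2_eq (negPf ax) eq_sym (negPf ba).
have Nab_bw : ab != bw.
  by rewrite -(inj_eq val_inj) Eab Ebw set2_eq (negPf aw) eq_sym (negPf ba).
have Nbx_bw : bx != bw.
  by rewrite -(inj_eq val_inj) Ebx Ebw set2_eq (negPf xw) andbF (negPf bw').
have Nbx_ab : bx != ab by rewrite eq_sym.
have Nbw_ab : bw != ab by rewrite eq_sym.
have Nbw_bx : bw != bx by rewrite eq_sym.
by case: i j ji {seeL repE jL cj} => [[|[|[|[|[|//]]]]] ?] [[|[|[|[|[|//]]]]] ?] //= _;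
  rewrite ?Nab_bx ?Nab_bw ?Nbx_bw ?Nbx_ab ?Nbw_ab ?Nbw_bx ?Eab ?Ebx ?Ebw ?Exz
    ?set2_meet ?inE ?eqxx ?orbT.
Qed.

(* The total dense paths [P1] and [P2] are [a, b, x] and [d, c, y], where [x] and [y]
   are on [Q]. Since [m_t G = 6] in type 2, total dense means [5 <= total_deg]. *)
Record pivot_pair (G : sgraph) (a b x d c y : G) (ab bx cd yc : edge G) : Prop :=
  PivotPair {
  pair_ab : val ab = [set a; b];
  pair_bx : val bx = [set b; x];
  pair_ax : a != x;
  pair_cd : val cd = [set d; c];
  pair_yc : val yc = [set c; y];
  pair_dy : d != y;
  pair_low : all (fun t : G => total_deg (inl t) <= 4) [:: a; x; d; y];
  pair_uniq : uniq ([:: inl b; inr ab; inr bx] ++ [:: inl c; inr cd; inr yc : element G]);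
  pair_dense : forall t : element G, (5 <= total_deg t) =
    (t \in [:: inl b; inr ab; inr bx] ++ [:: inl c; inr cd; inr yc : element G])
}.

(** * Pivot pairs and their extraction from type 2 *)

(** This exchange of the two paths lets each forcing argument be given for [bx] only. *)
Lemma pivot_pair_sym (G : sgraph) (a b x d c y : G) (ab bx cd yc : edge G) :
  pivot_pair a b x d c y ab bx cd yc -> pivot_pair d c y a b x cd yc ab bx.
Proof.
move=> [Eab Ebx ax Ecd Eyc dy low uS denseS].
apply: (PivotPair Ecd Eyc dy Eab Ebx ax).
- by move: low => /= /and5P[-> -> -> -> _].
- by rewrite uniq_catC.
by move=> t; rewrite denseS; apply: perm_mem; rewrite perm_catC.
Qed.

(** Up to reversal, [p] ends at the vertex it shares with [q], and this vertex is not dense because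
    [q] carries no dense element. *)
Lemma dense_path_end (G : sgraph) (p q : seq G) :
  total_dense_path p -> #|total_dense_on p| = 3 -> total_dense_on q = set0 ->
  path_adjacent q p ->
  exists a b x ab bx,
    [/\ [/\ x \in q, val ab = [set a; b], val bx = [set b; x] & a != x],
        ~~ total_dense (inl a : element G), ~~ total_dense (inl x : element G) &
        {subset total_dense_on p <= [:: inl b; inr ab; inr bx : element G]}].
Proof.
move=> pP p3 q0 adjqp.
have [x [p' [xq pE]]] : exists x p', x \in q /\ (p = rcons p' x \/ p = rev (rcons p' x)).
  case: adjqp => -[v [p' [q' [-> ->]]]].
    exists v, (rev q'); rewrite mem_rcons mem_head rev_rcons revK; by split; [|right].
  by exists v, q'; rewrite mem_head; split; [|left].
have xN : ~~ total_dense (inl x : element G).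
  by have /setP/(_ (inl x)) := q0; rewrite !inE /= xq => /= ->.
have rcP : total_dense_path (rcons p' x).
  by case: pE => E; [rewrite -E | rewrite -(revK (rcons _ _)) -E; apply: total_dense_path_rev].
have rcE : total_dense_on (rcons p' x) = total_dense_on p.
  by case: pE => ->; rewrite ?total_dense_on_rev.
have [|a [b [ab [bx [Eab Ebx ax aN sub]]]]] := three_dense_path rcP _ xN.
  by rewrite rcE.
by exists a, b, x, ab, bx; split; rewrite -?rcE.
Qed.

(** Every dense element is among the three listed for [P1] or the three for [P2], so [m_t G <= 6].
    Equality makes the six distinct and all dense. *)
Lemma type2_pivot_pair (G : sgraph) (P : seq G) :
  6 <= m_t G -> #|[set x : element G | total_dense x]| = m_t G ->
  pivoted_type2 P ->
  m_t G = 6 /\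
  exists (a b x d c y : G) (ab bx cd yc : edge G),
    pivot_pair a b x d c y ab bx cd yc /\ (x = y \/ adj x y).
Proof.
move=> m6 cardD [P1 [P2 [Q [_ [_ maxE] [card1 card2] [/and3P[_ Qs Qu] Q1 Q0] [adj1 adj2]]]]].
have P1P : total_dense_path P1.
  by have /maxE[] : same_path P1 P1 || same_path P1 P2 by rewrite /same_path eqxx.
have P2P : total_dense_path P2.
  by have /maxE[] : same_path P2 P1 || same_path P2 P2 by rewrite /same_path eqxx orbT.
have [a [b [x [ab [bx [[xQ Eab Ebx ax] aN xN sub1]]]]]] := dense_path_end P1P card1 Q0 adj1.
have [d [c [y [cd [yc [[yQ Ecd Eyc dy] dN yN sub2]]]]]] := dense_path_end P2P card2 Q0 adj2.
set S := [:: inl b; inr ab; inr bx] ++ [:: inl c; inr cd; inr yc : element G].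
have denseS : [set t : element G | total_dense t] \subset S.
  apply/subsetP=> t; rewrite inE => tD; rewrite mem_cat; apply/orP.
  case/orP: (dense_on_maximal_path (fun p => proj1 (maxE p)) tD).
    by move/sub1=> tS; left.
  by move/sub2=> tS; right.
have cardS : #|S| <= 6 := card_size S.
have m_eq : m_t G = 6.
  by apply/eqP; rewrite eqn_leq m6 andbT -cardD (leq_trans (subset_leq_card denseS)).
have cardS6 : #|S| = 6.
  by apply/eqP; rewrite eqn_leq cardS -[X in X <= _]m_eq -cardD subset_leq_card.
have denseE (t : element G) : (5 <= total_deg t) = total_dense t by rewrite /total_dense m_eq.
have SE : [set t : element G | total_dense t] =i S.
  by apply/subset_cardP; rewrite // cardD m_eq cardS6.
split=> //; exists a, b, x, d, c, y, ab, bx, cd, yc; split.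
  apply: (PivotPair Eab Ebx ax Ecd Eyc dy).
  - have lowP (t : G) : ~~ total_dense (inl t : element G) -> total_deg (inl t) <= 4.
      by rewrite leqNgt denseE.
    by rewrite /= !lowP.
    by apply/card_uniqP; rewrite cardS6.
  by move=> t; rewrite denseE -SE inE.
(* [Q] has one or two vertices, and both [x] and [y] lie on it. *)
move: Q Q1 Qs xQ yQ {Q0 Qu adj1 adj2} => [|s [|t []]] //= _.
  by rewrite !inE => _ /eqP-> /eqP->; left.
rewrite andbT !inE => st /orP[]/eqP-> /orP[]/eqP->; rewrite ?st; try by left.
  by right.
by right; rewrite adj_sym.
Qed.

(** The edges [cd] and [yc] avoid [b], so [ab] and [bx] are the only dense edges at [b], as
    [arm_exists] requires. *)
Lemma pivot_pair_arm (G : sgraph) (a b x d c y z : G) (ab bx cd yc : edge G) :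
  pivot_pair a b x d c y ab bx cd yc -> adj x z -> z != b ->
  exists w bw xz, arm a b x w z ab bx bw xz.
Proof.
move=> [Eab Ebx ax Ecd Eyc dy low uS denseS] xz zb.
have [lowd lowy] : total_deg (inl d) <= 4 /\ total_deg (inl y) <= 4.
  by have /allP low' := low; split; apply: low'; rewrite !inE eqxx ?orbT.
have lowx : total_deg (inl x) <= 4 by have /allP low' := low; apply: low'; rewrite !inE eqxx ?orbT.
have bD : 5 <= total_deg (inl b : element G) by rewrite denseS !inE eqxx.
have bxD : 5 <= total_deg (inr bx : element G) by rewrite denseS !inE eqxx ?orbT.
have bd : b != d by apply: contraTneq bD => ->; rewrite -ltnNge.
have by' : b != y by apply: contraTneq bD => ->; rewrite -ltnNge.
have bc : b != c.
  apply: contraTneq uS => ->; rewrite cat_uniq (_ : has _ _) ?andbF //.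
  by apply/hasP; exists (inl c); rewrite mem_head.
apply: (arm_exists Eab Ebx ax zb xz) => // f bf; rewrite denseS !inE !element_eqE /=.
case/or4P=> [/eqP/val_inj|/eqP/val_inj|/eqP/val_inj Ef|/eqP/val_inj Ef]; first by left.
- by right.
- by move: bf; rewrite Ef Ecd !inE (negPf bd) (negPf bc).
by move: bf; rewrite Ef Eyc !inE (negPf bc) (negPf by').
Qed.

Lemma neqF (V : eqType) (u v : V) : u != v -> ((u == v) = false) * ((v == u) = false).
Proof. by move=> /negPf uv; rewrite (eq_sym v) uv. Qed.

(** The total degree separates [b] and [c] from the four ends of the paths. *)
Lemma pivot_pair_neq (G : sgraph) (a b x d c y : G) (ab bx cd yc : edge G) :
  pivot_pair a b x d c y ab bx cd yc ->
  [/\ b != c, [&& b != a, b != x, b != d & b != y] &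
      [&& c != a, c != x, c != d & c != y]].
Proof.
move=> [Eab Ebx ax Ecd Eyc dy /allP low uS denseS].
have bD : 5 <= total_deg (inl b : element G) by rewrite denseS !inE eqxx.
have cD : 5 <= total_deg (inl c : element G) by rewrite denseS !inE eqxx ?orbT.
have neq u t : 5 <= total_deg (inl u : element G) -> t \in [:: a; x; d; y] -> u != t.
  by move=> uD /low; apply: contraTneq => <-; rewrite -ltnNge.
split; try by rewrite !neq // !inE eqxx ?orbT.
apply: contraTneq uS => ->; rewrite cat_uniq (_ : has _ _) ?andbF //.
by apply/hasP; exists (inl c); rewrite mem_head.
Qed.

(** * Colouring a pivot pair with five colours *)

Lemma pivot_pair_colouring (G : sgraph) (a b x d c y : G) (ab bx cd yc : edge G) :
  acyclic G -> pivot_pair a b x d c y ab bx cd yc -> x = y \/ adj x y ->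
  exists col : {ffun element G -> 'I_5}, total_b_colouring col.
Proof.
move=> acyc pair xy; have tri u v t := @acyclic_triangle_free G u v t acyc.
have [bc /and4P[ba bx' bd by'] /and4P[ca cx cd' cy]] := pivot_pair_neq pair.
have [Eab Ebx ax Ecd Eyc dy _ _ denseS] := pair.
have abx := edge_adj Ebx; have aba := edge_adj Eab.
have acd := edge_adj Ecd; have acy := edge_adj Eyc.
have axb : adj x b by rewrite adj_sym.
have abaC : adj b a by rewrite adj_sym.
have low (L : seq (seq (element G))) :
    all [in flatten L] ([:: inl b; inr ab; inr bx] ++ [:: inl c; inr cd; inr yc]) ->
    forall t, t \notin flatten L -> total_deg t < 5.
  by move=> /allP sub t; rewrite ltnNge denseS; apply: contra; apply: sub.
have adjF u v : adj b u -> adj b v -> adj u v = false.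
  by move=> bu bv; rewrite (tri v b) // adj_sym.
have negl := (neqF bc, neqF ba, neqF bx', neqF bd, neqF by', neqF ca, neqF cx,
  neqF cd', neqF cy, neqF ax, neqF dy).
case: xy => [xyE|xy].
  subst y.
  have xc : adj x c by rewrite adj_sym.
  have cb : c != b by rewrite eq_sym.
  have [w [bw [xz armP]]] := pivot_pair_arm pair xc cb.
  have [_ _ Ebw Exz /and4P[_ aw xw _] _ _] := armP.
  have Exz' : xz = yc by apply: val_inj; rewrite /= Exz Eyc setUC.
  subst xz.
  have abw := edge_adj Ebw; have awb : adj w b by rewrite adj_sym.
  have cw : c != w by apply: contraTneq xc => ->; rewrite adjF.
  (* Here [z = c] and [xz = yc], so those colours are prescribed; [cd] is free to join the class of
     [b]. *)
  apply: (arm_colouring armP (L := [:: [:: inl b; inr cd]; [:: inr ab; inr yc];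
     [:: inr bx]; [:: inr bw; inl c]; [:: inl a; inl x; inl w]])) => //.
  - rewrite /= !inE !element_eqE Eab Ebx Ebw Ecd Eyc !set2_eq.
    by rewrite !negl !(neqF (adj_neq abw)) !(neqF aw) !(neqF xw) !(neqF cw) ?andbF.
  - by rewrite /= Ecd Ebw !inE Eab Eyc set2_meet
      (adjF a x) // (adjF a w) // (adjF x w) // !negl (neqF cw) andbF.
  - by apply: low; rewrite /= !inE !eqxx ?orbT.
  - by rewrite mem_head.
  by rewrite mem_head.
(* Otherwise [b], [x], [y], [c] would form a 4-cycle. This separates [c] from [w]. *)
have cb : adj c b = false.
  apply/negP=> cb; have /acyc : cycle adj [:: b; x; y; c].
    by rewrite /= abx xy cb adj_sym acy.
  by rewrite /= !inE !negl (neqF (adj_neq xy)) => /(_ isT).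
have yb : y != b by rewrite eq_sym.
have [w [bw [xz armP]]] := pivot_pair_arm pair xy yb.
have [_ _ Ebw Exz /and4P[_ aw xw _] _ _] := armP.
have abw := edge_adj Ebw; have xNy := adj_neq xy.
have cw : c != w by apply: contraFneq cb => ->; rewrite adj_sym.
have ya : y != a by apply: contraTneq xy => ->; rewrite adjF.
have yw : y != w by apply: contraTneq xy => ->; rewrite adjF.
have dx : d != x by apply: contraTneq xy => <-; rewrite (tri y c) // adj_sym.
(* Here [z = y]. The classes of [b], [ab] and [bx] absorb [yc], [c] and [cd] respectively. *)
apply: (arm_colouring armP (L := [:: [:: inl b; inr yc]; [:: inr ab; inr xz; inl c];
   [:: inr bx; inr cd]; [:: inr bw; inl y]; [:: inl a; inl x; inl w]])) => //.
- rewrite /= !inE !element_eqE Eab Ebx Ebw Exz Ecd Eyc !set2_eq.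
  by rewrite !negl !(neqF (adj_neq abw)) !(neqF aw) !(neqF xw) !(neqF cw) !(neqF ya) !(neqF yw)
    !(neqF dx) !(neqF xNy) ?andbF.
- rewrite /= Ecd Ebw !inE Eab Eyc Exz Ebx !set2_meet !inE
    (adjF a x) // (adjF a w) // (adjF x w) //.
  by rewrite !negl (neqF ya) (neqF yw) (neqF dx) ?andbF.
- by apply: low; rewrite /= !inE !eqxx ?orbT.
- by rewrite mem_head.
- by move=> t; rewrite !inE => /orP[] ->; rewrite ?orbT.
by rewrite mem_head.
Qed.

(** * Obstruction to [m_t] colours in type 2 *)

(** All neighbours of [bx] are listed by [arm_tadj]; once [b] and [ab] are ruled out, three
    remain. *)
Lemma arm_sees (G : sgraph) (k : nat) (col : {ffun element G -> 'I_k})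
    (a b x w z : G) (ab bx bw xz : edge G) (t : element G) :
  arm a b x w z ab bx bw xz -> total_b_chromatic col (inr bx) ->
  col t <> col (inr bx) -> col t <> col (inl b) -> col t <> col (inr ab) ->
  [\/ col t = col (inl x), col t = col (inr bw) | col t = col (inr xz)].
Proof.
move=> armP bP /eqP /(b_chromatic_sees bP)[s /(arm_tadj armP) sN <-] Nb Nab.
move: sN Nb Nab; rewrite !inE => /or4P[/eqP->|/eqP->|/eqP->|/orP[]/eqP->] //;
  by [constructor 1 | constructor 2 | constructor 3].
Qed.

(** What a total b-chromatic [m_t G]-colouring satisfies in type 2. Keeping [k] general avoids
    transporting the colouring along [m_t G = 6]. *)
Definition rigid (G : sgraph) (k : nat) (col : {ffun element G -> 'I_k}) : Prop :=
  [/\ forall s t, tadj s t -> col s <> col t,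
      forall t, 5 <= total_deg t -> total_b_chromatic col t &
      forall s t, 5 <= total_deg s -> 5 <= total_deg t -> col s = col t -> s = t].

Lemma pivot_pair_colours (G : sgraph) (k : nat) (col : {ffun element G -> 'I_k})
    (a b x d c y : G) (ab bx cd yc : edge G) :
  pivot_pair a b x d c y ab bx cd yc -> rigid col ->
  uniq [:: col (inl b); col (inr ab); col (inr bx);
           col (inl c); col (inr cd); col (inr yc)].
Proof.
move=> [_ _ _ _ _ _ _ uS denseS] [_ _ inj].
have := uS; rewrite -(map_inj_in_uniq (f := col)) // => s t.
by rewrite -!denseS; apply: inj.
Qed.

Lemma pivot_pair_b_chromatic (G : sgraph) (k : nat) (col : {ffun element G -> 'I_k})
    (a b x d c y : G) (ab bx cd yc : edge G) :
  pivot_pair a b x d c y ab bx cd yc -> rigid col ->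
  total_b_chromatic col (inr bx).
Proof.
move=> [_ _ _ _ _ _ _ _ denseS] [_ cb _]; apply: cb.
by rewrite denseS !inE eqxx ?orbT.
Qed.

Ltac uniq_neqs U :=
  rewrite !cons_uniq !in_cons !negb_or in U;
  repeat match goal with
  | H : is_true (_ && _) |- _ =>
    let H' := fresh "N" in move/andP: H => [H' H]
  | H : is_true (negb (_ == _)) |- _ => move/eqP in H
  end.

(* [bx] can see the colour of [c] only on [bw], so it sees the one of [cd] on [x]. *)
Lemma pivot_pair_common_end (G : sgraph) (k : nat) (col : {ffun element G -> 'I_k})
    (a b x d c : G) (ab bx cd xc : edge G) :
  pivot_pair a b x d c x ab bx cd xc -> rigid col ->
  col (inl x) = col (inr cd).
Proof.
move=> pair colP; have U := pivot_pair_colours pair colP.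
have bxP := pivot_pair_b_chromatic pair colP.
have [bc _ _] := pivot_pair_neq pair.
have adjxc : adj x c by rewrite adj_sym (edge_adj (pair_yc pair)).
have cb : c != b by rewrite eq_sym.
have [w [bw [xz armP]]] := pivot_pair_arm pair adjxc cb.
have Exz : xz = xc.
  by apply: val_inj; rewrite /= (arm_xz armP) (pair_yc pair) setUC.
subst xz; have [proper _ _] := colP.
have Nxc : col (inl x) <> col (inl c) by apply: proper.
uniq_neqs U.
have [||| E|E|E] := arm_sees (t := inl c) armP bxP; try congruence.
by have [||| E'|E'|E'] := arm_sees (t := inr cd) armP bxP; congruence.
Qed.

(* [bx] sees the colours of [c], [cd] and [yc] on [x], [bw] and [xy]. *)
Lemma pivot_pair_middle_edge (G : sgraph) (k : nat) (col : {ffun element G -> 'I_k})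
    (a b x d c y : G) (ab bx cd yc e : edge G) :
  pivot_pair a b x d c y ab bx cd yc -> rigid col -> val e = [set x; y] ->
  [\/ col (inr e) = col (inl c), col (inr e) = col (inr cd) |
      col (inr e) = col (inr yc)].
Proof.
move=> pair colP Ee; have U := pivot_pair_colours pair colP.
have bxP := pivot_pair_b_chromatic pair colP.
have [_ /and4P[_ _ _ by'] _] := pivot_pair_neq pair.
have yb : y != b by rewrite eq_sym.
have [w [bw [xz armP]]] := pivot_pair_arm pair (edge_adj Ee) yb.
have Exz : xz = e by apply: val_inj; rewrite /= (arm_xz armP) Ee.
subst xz; uniq_neqs U.
(* The three colours are distinct, so unless that of [c] or [cd] is met on [e], these two occupy [x]
   and [bw], and that of [yc] is left with [e]. *)
have [||| E1|E1|E1] := arm_sees (t := inl c) armP bxP; try congruence;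
  last by constructor 1.
all: have [||| E2|E2|E2] := arm_sees (t := inr cd) armP bxP; try congruence;
  last by constructor 2.
all: have [||| E3|E3|E3] := arm_sees (t := inr yc) armP bxP; try congruence.
all: by constructor 3.
Qed.

(** The two paths impose on one and the same element, [x] or the edge [xy], colours from two
    disjoint sets. *)
Lemma pivot_pair_not_rigid (G : sgraph) (k : nat) (col : {ffun element G -> 'I_k})
    (a b x d c y : G) (ab bx cd yc : edge G) :
  pivot_pair a b x d c y ab bx cd yc -> x = y \/ adj x y -> ~ rigid col.
Proof.
move=> pair xy colP; have U := pivot_pair_colours pair colP.
have pair' := pivot_pair_sym pair.
case: xy => [xyE|xy].
  subst y; have E := pivot_pair_common_end pair colP.
  have E' := pivot_pair_common_end pair' colP.
  by uniq_neqs U; congruence.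
have [e Ee] := edge_exists xy.
have E := pivot_pair_middle_edge pair colP Ee.
have E' := pivot_pair_middle_edge pair' colP (etrans Ee (setUC _ _)).
by uniq_neqs U; case: E => E; case: E' => E'; congruence.
Qed.

(** * Combination of the two types *)

Theorem theorem3 (T : sgraph) :
  total_pivoted_caterpillar T ->
  (exists c : {ffun element T -> 'I_(m_t T - 1)}, total_b_colouring c) /\
  phi_t T = m_t T - 1.
Proof.
case=> P [[[_ _ acyc] _ _] m6 cardD pivoted].
suff [has_col no_m] :
    (exists c : {ffun element T -> 'I_(m_t T - 1)}, total_b_colouring c) /\
    (forall c : {ffun element T -> 'I_(m_t T)}, ~~ total_b_colouring c).
  by split=> //; apply: phi_t_pivot.
case: pivoted => [[u [u' [v [[uD du] [uu' du'] [u'v vD vu]]]]]|/type2_pivot_pair].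
  have denseE := type1_dense m6 cardD du uD vD vu.
  (* An edge [uv] would close a triangle with [u']. *)
  have nuv : ~~ adj u v by rewrite adj_sym (acyclic_triangle_free acyc uu' u'v).
  split; first exact: type1_has_colouring m6 du vu nuv denseE.
  by move=> c; apply: (type1_no_m_colouring _ cardD uu' du' u'v vu denseE).
case=> // m_eq [a [b [x [d [c [y [ab [bx [cd [yc [pair xy]]]]]]]]]]].
split; first by rewrite m_eq; apply: (pivot_pair_colouring acyc pair xy).
move=> col; apply/negP=> colP; apply: (pivot_pair_not_rigid (col := col) pair xy).
have [bP inj] := dense_b_chromatic cardD colP.
have denseE (t : element T) : (5 <= total_deg t) = total_dense t.
  by rewrite /total_dense m_eq.
split=> [s t st|t|s t]; rewrite ?denseE; [|exact: bP|exact: inj].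
case/andP: colP => /andP[_ /'forall_forallP proper] _; apply/eqP.
exact: (implyP (proper s t)).
Qed.
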